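(* The parity-HIST model is Turing complete.
   Context: ''Turing complete'' means equivalent to Turing machines in terms of computational power. **HIST machines.** A HIST machine is a tuple $(\Sigma,Q,\delta,q_{\mathrm{start}},q_{\mathrm{halt}})$, where $\Sigma$ is a finite tape alphabet containing a blank symbol $\perp$, a start symbol $\triangleright$, and the symbols $0,1$; $Q$ is a finite set of states containing the start state $q_{\mathrm{start}}$ and the halting state $q_{\mathrm{halt}}$; and $\delta:Q\times\mathbb{N}^{\Sigma}\to Q\times(\Sigma\cup\Sigma^2)$ is the transition function. The machine has a single tape, bounded on the left and infinite to the right, with a front head and a rear head. Initially the tape contains, from the leftmost cell rightward, $\triangleright$, then a finite input string $x\in\{0,1\}^*$, then blanks $\perp$ on all remaining cells. The front head starts on the cell immediately to the right of $\triangleright$, the rear head starts at the right end of the input, and the machine starts in state $q_{\mathrm{start}}$. The *window* is the interval of tape cells between the front and rear heads, including both endpoints. The machine repeats the following step until it enters $q_{\mathrm{halt}}$. Suppose the current state is $q$ and the histogram of the symbols in the current window is $\vec h\in\mathbb{N}^\Sigma$ (where $\vec h(\sigma)$ is the number of occurrences of $\sigma$ in the window). If $\delta(q,\vec h)=(q',\sigma')$ with $q'\in Q$ and $\sigma'\in\Sigma\cup\Sigma^2$, then the state becomes $q'$, the front head moves one cell to the right, the rear head moves $|\sigma'|$ cells to the right, and the string $\sigma'$ is written in the newly exposed cell(s) at the right end. **Parity-HIST machines.** A HIST machine is a parity-HIST machine if its transition depends on the histogram $\vec h$ only through its parity vector $(\vec h \bmod 2)\in\{0,1\}^\Sigma$;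 equivalently, the transition function can be viewed as a map $\delta:Q\times\{0,1\}^\Sigma\to Q\times(\Sigma\cup\Sigma^2)$. The parity-HIST model is the model of computation given by parity-HIST machines. *)

(* Defs.v *)
From mathcomp Require Import all_boot all_order all_algebra.

Set Implicit Arguments.
Unset Strict Implicit.
Unset Printing Implicit Defensive.

(* [t 0, t 1, ...] starts with exactly the bit string [y]: the cell following
   [y] carries neither [zero] nor [one]. *)
Definition reads_word (S : eqType) (zero one : S) (t : nat -> S)
    (y : seq bool) : Prop :=
  [seq if b then one else zero | b <- y] = mkseq t (size y) /\
  t (size y) \notin [:: zero; one].

(* A model of computation on bit strings. [outputs M x y] means that [M] halts
   on the input [x] with output [y]. *)
Record model := Model {
  machine : Type;
  halts : machine -> seq bool -> Prop;
  outputs : machine -> seq bool -> seq bool -> Prop }.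

Definition recognizable (C : model) (L : seq bool -> Prop) : Prop :=
  exists M : machine C, forall x, L x <-> halts M x.

(* Partial functions are given by their graphs. *)
Definition computable (C : model) (F : seq bool -> seq bool -> Prop) : Prop :=
  exists M : machine C, forall x y, F x y <-> outputs M x y.

Module TM.

(* Deterministic, with a single two-way infinite tape. *)
Record tm := Machine {
  sym : finType;
  blank : sym;
  zero : sym;
  one : sym;
  sym_uniq : uniq [:: blank; zero; one];
  state : finType;
  start : state;
  halt : state;
  delta : state -> sym -> state * sym * option bool }.

(* [Some false] is left, [Some true] is right, [None] is no move. *)
Definition shift (m : option bool) : int :=
  match m with
  | Some false => (-1)%R
  | Some true => 1%R
  | None => 0%R
  end.

Record config (M : tm) := Config {
  cstate : state M;
  tape : int -> sym M;
  head : int }.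

Definition init (M : tm) (x : seq bool) : config M :=
  Config (start M)
    (fun i => match i with
              | Posz n => nth (blank M) [seq if b then one M else zero M | b <- x] n
              | Negz _ => blank M
              end)
    0%R.

Definition step (M : tm) (c : config M) : config M :=
  if cstate c == halt M then c else
  let: (q, s, m) := delta (cstate c) (tape c (head c)) in
  Config q (fun i => if i == head c then s else tape c i)
    (head c + shift m)%R.

Definition run (M : tm) (x : seq bool) (n : nat) : config M :=
  iter n (@step M) (init M x).

Definition halts_on (M : tm) (x : seq bool) : Prop :=
  exists n, cstate (run M x n) = halt M.

(* The output is the maximal bit string starting at the head. *)
Definition outputs_on (M : tm) (x y : seq bool) : Prop :=
  exists n, let c := run M x n in
    cstate c = halt M /\
    reads_word (zero M) (one M) (fun i => tape c (head c + i%:Z)%R) y.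

Definition tm_model : model := Model halts_on outputs_on.

End TM.

Module HIST.

Record hist := Machine {
  sym : finType;
  blank : sym;
  lmark : sym; (* the start symbol of the tape *)
  zero : sym;
  one : sym;
  sym_uniq : uniq [:: blank; lmark; zero; one];
  state : finType;
  start : state;
  halt : state;
  delta : state -> {ffun sym -> nat} -> state * (sym + sym * sym) }.

Definition parity (M : hist) : Prop :=
  forall (q : state M) (h1 h2 : {ffun sym M -> nat}),
    (forall s, odd (h1 s) = odd (h2 s)) -> delta q h1 = delta q h2.

Definition word (S : Type) (w : S + S * S) : seq S :=
  match w with
  | inl a => [:: a]
  | inr (a, b) => [:: a; b]
  end.

Record config (M : hist) := Config {
  cstate : state M;
  tape : nat -> sym M;
  front : nat;
  rear : nat }.

(* On the empty input the rear head starts on cell 0, just left of the front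
   head, and the window is empty. *)
Definition init (M : hist) (x : seq bool) : config M :=
  Config (start M)
    (nth (blank M) (lmark M :: [seq if b then one M else zero M | b <- x]))
    1 (size x).

Definition window (M : hist) (c : config M) : seq (sym M) :=
  [seq tape c i | i <- index_iota (front c) (rear c).+1].

Definition histogram (M : hist) (c : config M) : {ffun sym M -> nat} :=
  [ffun s => count_mem s (window c)].

Definition step (M : hist) (c : config M) : config M :=
  if cstate c == halt M then c else
  let: (q, e) := delta (cstate c) (histogram c) in
  let w := word e in
  Config q
    (fun i => if rear c < i <= rear c + size w
              then nth (blank M) w (i - (rear c).+1) else tape c i)
    (front c).+1 (rear c + size w).

Definition run (M : hist) (x : seq bool) (n : nat) : config M :=
  iter n (@step M) (init M x).

Definition halts_on (M : hist) (x : seq bool) : Prop :=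
  exists n, cstate (run M x n) = halt M.

(* The output is the maximal bit string starting at the front head; it lies in
   the window, as all cells to the right of the rear head are blank. *)
Definition outputs_on (M : hist) (x y : seq bool) : Prop :=
  exists n, let c := run M x n in
    cstate c = halt M /\
    reads_word (zero M) (one M) (fun i => tape c (front c + i)) y.

Definition parity_model : model :=
  @Model {M : hist | parity M}
    (fun M => halts_on (sval M)) (fun M => outputs_on (sval M)).

End HIST.

(* The same computational power as Turing machines, both for recognizing
   languages by halting and for computing partial functions. *)
Definition turing_complete (C : model) : Prop :=
  (forall L, recognizable C L <-> recognizable TM.tm_model L) /\
  (forall F, computable C F <-> computable TM.tm_model F).

(* Main.v *)
(* The window of a HIST machine is a queue that loses its front symbol and gains
   one or two symbols in each step. A Turing machine keeps the queue on its tape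
   and the parities in its state.

   Conversely, a parity machine never sees the symbol that it removes, but the
   change of the parities betrays it one step later. So it can act as a queue
   machine that reads its front symbol, with the symbol already read being out of
   the window. Such a machine stores a Turing tape cyclically, with the scanned
   cell marked. It moves the mark to the right directly, and to the left by
   delaying every symbol by one during a full rotation, for which an extra
   separator is inserted since the queue cannot shrink. *)

From HB Require Import structures.
From mathcomp Require Import all_boot all_order all_algebra zify.
Require Import Defs.

Set Implicit Arguments.
Unset Strict Implicit.
Unset Printing Implicit Defensive.

(** * Step-by-step simulation of one deterministic system by another *)

Lemma iter_fixed (C : Type) (f : C -> C) (c : C) n : f c = c -> iter n f c = c.
Proof. by move=> fc; elim: n => //= n ->. Qed.

(** [R] need only hold after some start-up steps of [g]. Each step of [f] costs at least one step of
    [g], so a halting run of [g] bounds the run of [f]: the converse goes by strong induction on the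
    steps of [g] still to come. *)
Lemma simulation (C D : Type) (f : C -> C) (g : D -> D)
    (haltC : pred C) (haltD : pred D) (P : C -> Prop) (Q : D -> Prop)
    (R : C -> D -> Prop) (c0 : C) (d0 : D) :
  (forall c, haltC c -> f c = c) -> (forall d, haltD d -> g d = d) ->
  (forall c d, R c d -> haltD d -> haltC c) ->
  (forall c d, R c d -> ~~ haltC c -> exists k, R (f c) (iter k.+1 g d)) ->
  (forall c d, R c d -> haltC c ->
     exists k, haltD (iter k g d) /\ (P c <-> Q (iter k g d))) ->
  (exists k, R c0 (iter k g d0)) ->
  (exists n, haltC (iter n f c0) /\ P (iter n f c0)) <->
  (exists n, haltD (iter n g d0) /\ Q (iter n g d0)).
Proof.
move=> fixC fixD Rlive Rstep Rhalt [k0 R0]; split=> [[n [hn Pn]]|[n [hn Qn]]].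
  suff: exists m, haltD (iter m g (iter k0 g d0)) /\ Q (iter m g (iter k0 g d0)).
    by case=> m; rewrite -iterD => ?; exists (m + k0).
  move: hn Pn; elim: n c0 {d0} (iter k0 g d0) R0 => [|n IHn] c d Rcd hn Pn.
    by have [k [hk PQ]] := Rhalt _ _ Rcd hn; exists k; split=> //; apply/PQ.
  have [hc|hc] := boolP (haltC c).
    by move: hn Pn; rewrite !iterSr fixC //; apply: IHn.
  have [k Rk] := Rstep _ _ Rcd hc; rewrite iterSr in hn Pn.
  have [m] := IHn _ _ Rk hn Pn.
  by rewrite -iterD => ?; exists (m + k.+1).
(* Halted configurations are fixed, so the start-up steps can be put before the [n] steps. *)
have {hn Qn} [hn Qn] : haltD (iter n g (iter k0 g d0)) /\ Q (iter n g (iter k0 g d0)).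
  by rewrite -iterD addnC iterD iter_fixed //; apply: fixD.
elim/ltn_ind: n c0 {d0} (iter k0 g d0) R0 hn Qn => n IHn c d Rcd hn Qn.
(* A run meets only one halted configuration, so [Q] there is [Q] at [iter n g d]. *)
have Phalt c' d' : R c' d' -> haltC c' -> (exists k, iter k g d' = iter n g d) -> P c'.
  move=> Rcd' hc [j ej]; have [k [hk PQ]] := Rhalt _ _ Rcd' hc; apply/PQ.
  have hj : haltD (iter j g d') by rewrite ej.
  have := iter_fixed k (fixD _ hj); rewrite -iterD addnC iterD.
  by rewrite (iter_fixed j (fixD _ hk)) ej => ->.
have [hc|hc] := boolP (haltC c); first by exists 0; split=> //=; apply: Phalt Rcd hc _; exists n.
have [k Rk] := Rstep _ _ Rcd hc.
(* If [g] halts before it has completed the step of [f], then [f c] is related to a halted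
   configuration and has halted too. *)
have [le_nk|lt_kn] := leqP n k.
  have e : iter k.+1 g d = iter n g d.
    by rewrite -(subnK (leqW le_nk)) iterD iter_fixed //; apply: fixD.
  have hfc : haltC (f c) by apply: Rlive Rk _; rewrite e.
  by exists 1; split=> //=; apply: Phalt Rk hfc _; exists 0.
have en : iter n g d = iter (n - k.+1) g (iter k.+1 g d) by rewrite -iterD subnK.
rewrite en in hn Qn.
have [|m] := IHn (n - k.+1) _ _ _ Rk hn Qn; first by lia.
by rewrite -iterSr => ?; exists m.+1.
Qed.

Lemma reads_wordP (S : eqType) (zero one : S) (t : nat -> S) (y : seq bool) :
  reads_word zero one t y <->
  (forall i, i < size y -> t i = if nth false y i then one else zero) /\
  t (size y) \notin [:: zero; one].
Proof.
rewrite /reads_word; split=> -[e ?]; split=> //.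
  move=> i lt_iy; move/(congr1 (fun s => nth zero s i)): e.
  by rewrite nth_mkseq // (nth_map false).
apply: (@eq_from_nth _ zero); rewrite size_map ?size_mkseq // => i lt_iy.
by rewrite nth_mkseq // (nth_map false) // e.
Qed.

(** Neither word extends past [n], where both sequences carry a non-bit. There they need not
    correspond under [f], so the two models may have unrelated blanks. *)
Lemma reads_word_transfer (S S' : eqType) (f : S -> S') (zero one : S)
    (t : nat -> S) (t' : nat -> S') (n : nat) (y : seq bool) :
  injective f -> (forall i, i < n -> t' i = f (t i)) ->
  t n \notin [:: zero; one] -> t' n \notin [:: f zero; f one] ->
  reads_word zero one t y <-> reads_word (f zero) (f one) t' y.
Proof.
move=> injf tt' tn t'n; rewrite !reads_wordP.
have notin_f s : (f s \notin [:: f zero; f one]) = (s \notin [:: zero; one]).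
  by rewrite !inE !(inj_eq injf).
have le_yn (T : eqType) (z o : T) (u : nat -> T) : u n \notin [:: z; o] ->
    (forall i, i < size y -> u i = if nth false y i then o else z) -> size y <= n.
  move=> un eu; rewrite leqNgt; apply: contra un => /eu->.
  by case: ifP; rewrite !inE eqxx ?orbT.
split=> -[e yn]; have le := le_yn _ _ _ _ _ e.
  have {}le := le tn; split=> [i lt_iy|].
    by rewrite tt' ?e //; [case: ifP|apply: leq_trans le].
  by move: le; rewrite leq_eqVlt => /orP[/eqP->//|lt]; rewrite tt' // notin_f.
have {}le := le t'n; split=> [i lt_iy|].
  by apply: injf; rewrite -tt' ?e //; [case: ifP|apply: leq_trans le].
by move: le yn; rewrite leq_eqVlt => /orP[/eqP->//|lt]; rewrite tt' // notin_f.
Qed.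

(** * Turing machines with the tape as a pair of finite lists *)

Section Zipper.
Variable M : TM.tm.
Implicit Types (c : TM.config M) (l r : seq (TM.sym M)).

(* [(q, l, r)]: [r] starts with the scanned cell, [l] lists the cells to its
   left, nearest first, and all remaining cells are blank. *)
Definition zipper : Type := TM.state M * seq (TM.sym M) * seq (TM.sym M).

Definition zhalted (z : zipper) : bool := z.1.1 == TM.halt M.

Definition zstep (z : zipper) : zipper :=
  let: (q, l, r) := z in
  if q == TM.halt M then z else
  let: (q', s, m) := TM.delta q (head (TM.blank M) r) in
  match m with
  | None => (q', l, s :: behead r)
  | Some true => (q', s :: l, behead r)
  | Some false => (q', behead l, head (TM.blank M) l :: s :: behead r)
  end.

Definition tm_word (x : seq bool) : seq (TM.sym M) :=
  [seq if b then TM.one M else TM.zero M | b <- x].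

Definition zinit (x : seq bool) : zipper := (TM.start M, [::], tm_word x).

Definition zreads (y : seq bool) (z : zipper) : Prop :=
  reads_word (TM.zero M) (TM.one M) (nth (TM.blank M) z.2) y.

Definition zipper_cell l r (i : int) : TM.sym M :=
  match i with
  | Posz n => nth (TM.blank M) r n
  | Negz n => nth (TM.blank M) l n
  end.

(** Positions are taken relative to the head, so a move is a mere reindexing. *)
Definition represents c (z : zipper) : Prop :=
  TM.cstate c = z.1.1 /\
  forall i, TM.tape c (TM.head c + i)%R = zipper_cell z.1.2 z.2 i.

Lemma zstep_halted (z : zipper) : zhalted z -> zstep z = z.
Proof. by case: z => [[q l] r]; rewrite /zhalted /zstep /= => ->. Qed.

Lemma represents_init x : represents (TM.init M x) (zinit x).
Proof. by split=> // i /=; rewrite GRing.add0r; case: i => [|n] //=; rewrite nth_nil. Qed.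

Lemma represents_step c z : represents c z -> represents (TM.step c) (zstep z).
Proof.
case: z => [[q l] r] [/= qc tc]; rewrite /TM.step /zstep qc.
case: ifP => [_|_]; first by [].
have -> : TM.tape c (TM.head c) = head (TM.blank M) r.
  by rewrite -nth0 -[RHS]/(zipper_cell l r 0%R) -tc GRing.addr0.
case: (TM.delta _ _) => [[q' s] m].
have tape_at j k : (TM.head c + j + k == TM.head c)%R = (j + k == 0)%R.
  by rewrite -GRing.addrA -[RHS](inj_eq (GRing.addrI (TM.head c))) GRing.addr0.
case: m => [[]|]; split=> //= i; rewrite tape_at -GRing.addrA tc.
- case: i => [n|[|n]] //.
  + have -> : (TM.shift (Some true) + Posz n = Posz n.+1)%R by rewrite /=; lia.
    by rewrite /= nth_behead.
  + by have -> : (TM.shift (Some true) + Negz n.+1 = Negz n)%R by rewrite /=; lia.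
- case: i => [[|[|n]]|n].
  + by rewrite GRing.addr0 /= nth0.
  + by [].
  + have -> : (TM.shift (Some false) + Posz n.+2 = Posz n.+1)%R by rewrite /=; lia.
    by rewrite /= nth_behead.
  + have -> : (TM.shift (Some false) + Negz n = Negz n.+1)%R by rewrite /=; lia.
    by rewrite /= nth_behead.
- by rewrite GRing.add0r; case: i => [[|n]|n] //=; rewrite nth_behead.
Qed.

Lemma represents_run x n :
  represents (TM.run M x n) (iter n zstep (zinit x)).
Proof.
by elim: n => [|n IHn]; [exact: represents_init|exact: represents_step].
Qed.

Lemma tm_haltsP x :
  TM.halts_on M x <-> exists n, zhalted (iter n zstep (zinit x)) /\ True.
Proof.
split=> [[n hn]|[n [/eqP hn _]]]; exists n; have [e _] := represents_run x n.
  by rewrite /zhalted -e hn.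
by rewrite e.
Qed.

Lemma tm_outputsP x y :
  TM.outputs_on M x y <->
  exists n, zhalted (iter n zstep (zinit x)) /\
            zreads y (iter n zstep (zinit x)).
Proof.
have readsE n : reads_word (TM.zero M) (TM.one M) (fun i : nat =>
      TM.tape (TM.run M x n) (TM.head (TM.run M x n) + i%:Z)%R) y <->
    zreads y (iter n zstep (zinit x)).
  have [_ tn] := represents_run x n; rewrite /zreads !reads_wordP.
  by rewrite !tn; split=> -[e ?]; split=> // i /e; rewrite tn.
split=> -[n [hn yn]]; exists n; have [e _] := represents_run x n.
  by rewrite /zhalted -e hn; split=> //; apply/readsE.
by split; [rewrite e; apply/eqP|apply/readsE].
Qed.

End Zipper.

(** * HIST machines as queues *)

Section Queue.
Variable M : HIST.hist.
Implicit Types (c : HIST.config M) (w : seq (HIST.sym M)).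

Definition qconfig : Type := HIST.state M * seq (HIST.sym M).

Definition qhalted (c : qconfig) : bool := c.1 == HIST.halt M.

Definition qhist w : {ffun HIST.sym M -> nat} := [ffun s => count_mem s w].

(** Appending precedes removal because the window may be empty: the front head then passes over the
    first symbol just written. *)
Definition qstep (c : qconfig) : qconfig :=
  let: (q, w) := c in
  if q == HIST.halt M then c else
  let: (q', e) := HIST.delta q (qhist w) in (q', behead (w ++ HIST.word e)).

Definition hist_word (x : seq bool) : seq (HIST.sym M) :=
  [seq if b then HIST.one M else HIST.zero M | b <- x].

Definition qinit (x : seq bool) : qconfig := (HIST.start M, hist_word x).

Definition qreads (y : seq bool) (c : qconfig) : Prop :=
  reads_word (HIST.zero M) (HIST.one M) (nth (HIST.blank M) c.2) y.

Definition has_window c (d : qconfig) : Prop :=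
  [/\ HIST.cstate c = d.1, (HIST.rear c).+1 = HIST.front c + size d.2
    & forall i, HIST.tape c (HIST.front c + i) = nth (HIST.blank M) d.2 i].

Lemma qstep_halted (d : qconfig) : qhalted d -> qstep d = d.
Proof. by case: d => q w; rewrite /qhalted /qstep /= => ->. Qed.

Lemma has_window_init x : has_window (HIST.init M x) (qinit x).
Proof. by split=> //=; rewrite size_map. Qed.

Lemma has_window_step c d : has_window c d -> has_window (HIST.step c) (qstep d).
Proof.
case: d => q w [/= qc rc tc]; rewrite /HIST.step /qstep qc.
case: ifP => // _.
have -> : HIST.histogram c = qhist w.
  apply/ffunP => s; rewrite !ffunE /HIST.window rc; congr count.
  apply: (@eq_from_nth _ (HIST.blank M)); rewrite size_map size_iota addKn // => i lt_iw.
  by rewrite (nth_map 0) ?size_iota ?addKn // nth_iota ?addKn // tc.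
case: (HIST.delta _ _) => q' e; split=> //=.
  have : 0 < size (HIST.word e) by case: e => [|[]].
  by rewrite size_behead size_cat; lia.
move=> i; rewrite nth_behead nth_cat.
have -> : (HIST.front c).+1 + i = HIST.front c + i.+1 by lia.
case: ifP => [/andP[lt _]|ge].
  have -> : i.+1 < size w = false by lia.
  by congr nth; lia.
rewrite tc; case: ifP => // ge_w; rewrite !nth_default //; lia.
Qed.

Lemma has_window_run x n :
  has_window (HIST.run M x n) (iter n qstep (qinit x)).
Proof.
by elim: n => [|n IHn]; [exact: has_window_init|exact: has_window_step].
Qed.

Lemma hist_haltsP x :
  HIST.halts_on M x <-> exists n, qhalted (iter n qstep (qinit x)) /\ True.
Proof.
split=> [[n hn]|[n [/eqP hn _]]]; exists n; have [e _ _] := has_window_run x n.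
  by rewrite /qhalted -e hn.
by rewrite e.
Qed.

Lemma hist_outputsP x y :
  HIST.outputs_on M x y <->
  exists n, qhalted (iter n qstep (qinit x)) /\
            qreads y (iter n qstep (qinit x)).
Proof.
have readsE n : reads_word (HIST.zero M) (HIST.one M) (fun i =>
      HIST.tape (HIST.run M x n) (HIST.front (HIST.run M x n) + i)) y <->
    qreads y (iter n qstep (qinit x)).
  have [_ _ tn] := has_window_run x n; rewrite /qreads !reads_wordP.
  by rewrite !tn; split=> -[e ?]; split=> // i /e; rewrite tn.
split=> -[n [hn yn]]; exists n; have [e _ _] := has_window_run x n.
  by rewrite /qhalted -e hn; split=> //; apply/readsE.
by split; [rewrite e; apply/eqP|apply/readsE].
Qed.

End Queue.

(** * Reachability and parity vectors *)

Definition reaches (C : Type) (f : C -> C) (c d : C) : Prop :=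
  exists k, iter k f c = d.

Lemma reaches_refl (C : Type) (f : C -> C) (c : C) : reaches f c c.
Proof. by exists 0. Qed.

Lemma reaches_step (C : Type) (f : C -> C) (c d : C) :
  reaches f (f c) d -> reaches f c d.
Proof. by case=> k <-; exists k.+1; rewrite iterSr. Qed.

Lemma reaches_trans (C : Type) (f : C -> C) (c d e : C) :
  reaches f c d -> reaches f d e -> reaches f c e.
Proof. by case=> j <- [k <-]; exists (k + j); rewrite iterD. Qed.

Definition parities (S : finType) (w : seq S) : {ffun S -> bool} :=
  [ffun s => odd (count_mem s w)].

Definition flip (S : finType) (p : {ffun S -> bool}) (w : seq S) :
  {ffun S -> bool} := [ffun s => p s (+) odd (count_mem s w)].

Lemma flip_parities (S : finType) (v w : seq S) :
  flip (parities v) w = parities (v ++ w).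
Proof. by apply/ffunP => s; rewrite !ffunE count_cat oddD. Qed.

Lemma flip_flip (S : finType) (p : {ffun S -> bool}) (v w : seq S) :
  flip (flip p v) w = flip p (v ++ w).
Proof. by apply/ffunP => s; rewrite !ffunE count_cat oddD addbA. Qed.

(** Modulo 2, removing a symbol is the same flip as adding it. *)
Lemma flip_parities_cons (S : finType) (a : S) (w : seq S) :
  flip (parities (a :: w)) [:: a] = parities w.
Proof. by apply/ffunP => s; rewrite !ffunE /= addn0 oddD addbC addKb. Qed.

(** * A Turing machine simulating a parity-HIST machine *)

Section SimulateParityHist.
Variable M : HIST.hist.
Hypothesis parityM : HIST.parity M.

Local Notation S := (HIST.sym M).
Local Notation Q := (HIST.state M).
Local Notation P := {ffun S -> bool}.

(** [Scan] counts the parities of the input and [Rewind] goes back to its left end. One HIST step is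
    then [Loop] (choose the transition), [Append] (write at the right end), [Return] (go back left)
    and [Pop] (erase the front cell). In [Append], [Return] and [Pop] the parities already include
    the appended word. *)
Inductive sim_state :=
  | Scan of P
  | Loop of Q & P
  | Append of Q & P & (S + S * S)
  | Rewind of Q & P
  | Return of Q & P
  | Pop of Q & P
  | Stop.

Definition sim_state_encode (s : sim_state) :
    option (P + (Q * P + (Q * P * (S + S * S) + (Q * P + (Q * P + Q * P))))) :=
  match s with
  | Scan p => Some (inl p)
  | Loop q p => Some (inr (inl (q, p)))
  | Append q p e => Some (inr (inr (inl (q, p, e))))
  | Rewind q p => Some (inr (inr (inr (inl (q, p)))))
  | Return q p => Some (inr (inr (inr (inr (inl (q, p))))))
  | Pop q p => Some (inr (inr (inr (inr (inr (q, p))))))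
  | Stop => None
  end.

Definition sim_state_decode s : sim_state :=
  match s with
  | Some (inl p) => Scan p
  | Some (inr (inl (q, p))) => Loop q p
  | Some (inr (inr (inl (q, p, e)))) => Append q p e
  | Some (inr (inr (inr (inl (q, p))))) => Rewind q p
  | Some (inr (inr (inr (inr (inl (q, p)))))) => Return q p
  | Some (inr (inr (inr (inr (inr (q, p)))))) => Pop q p
  | None => Stop
  end.

Lemma sim_state_encodeK : cancel sim_state_encode sim_state_decode.
Proof. by case. Qed.

HB.instance Definition _ := Countable.copy sim_state (can_type sim_state_encodeK).
HB.instance Definition _ : isFinite sim_state := CanIsFinite sim_state_encodeK.

(* HIST symbols are wrapped in [Some], since a blank of the HIST machine may
   occur in the window and must differ from the blank outside of it. *)
Definition sim_delta (st : sim_state) (a : option S) :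
    sim_state * option S * option bool :=
  match st, a with
  | Scan p, Some s => (Scan (flip p [:: s]), a, Some true)
  | Scan p, None => (Rewind (HIST.start M) p, a, Some false)
  | Loop q p, _ =>
      if q == HIST.halt M then (Stop, a, None) else
      let: (q', e) := HIST.delta q [ffun s => p s : nat] in
      (Append q' (flip p (HIST.word e)) e, a, None)
  | Append _ _ _, Some _ => (st, a, Some true)
  | Append q p (inl s), None => (Return q p, Some s, Some false)
  | Append q p (inr (s, s')), None => (Append q p (inl s'), Some s, Some true)
  | Rewind _ _, Some _ | Return _ _, Some _ => (st, a, Some false)
  | Rewind q p, None => (Loop q p, None, Some true)
  | Return q p, None => (Pop q p, None, Some true)
  | Pop q p, Some s => (Loop q (flip p [:: s]), None, Some true)
  | Pop _ _, None | Stop, _ => (Stop, None, None)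
  end.

Lemma sim_sym_uniq :
  uniq [:: None; Some (HIST.zero M); Some (HIST.one M)].
Proof.
have := HIST.sym_uniq M; rewrite /= !inE !negb_or !andbT => /and3P[_ _].
by apply: contra => /eqP[->].
Qed.

Definition sim_tm : TM.tm :=
  TM.Machine sim_sym_uniq (Scan (parities [::])) Stop sim_delta.

Local Notation step := (@zstep sim_tm).
Local Notation conf st l r := ((st, l, r) : zipper sim_tm).
Local Notation padded w j := ([seq Some s | s <- w] ++ nseq j (@None S)).

Lemma reach_scan p l w j :
  reaches step (conf (Scan p) l (padded w j))
    (conf (Scan (flip p w)) ([seq Some s | s <- rev w] ++ l) (nseq j None)).
Proof.
elim: w p l => [|a w IHw] p l.
  have -> : flip p [::] = p by apply/ffunP => s; rewrite !ffunE addbF.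
  exact: reaches_refl.
apply: reaches_step; have := IHw (flip p [:: a]) (Some a :: l).
by rewrite flip_flip rev_cons map_rcons cat_rcons.
Qed.

Lemma reach_end q p e l w j :
  reaches step (conf (Append q p e) l (padded w j))
    (conf (Append q p e) ([seq Some s | s <- rev w] ++ l) (nseq j None)).
Proof.
elim: w l => [|a w IHw] l; first exact: reaches_refl.
apply: reaches_step; have := IHw (Some a :: l).
by rewrite rev_cons map_rcons cat_rcons; case: e {IHw} => [s|[s s']].
Qed.

(** Shared by [Rewind] and [Return]. Here [w] is read leftwards from the scanned cell; [head] and
    [behead] also cover a head already on the blank to the left of the window. *)
Lemma reach_front (st st' : sim_state) w k r :
  (forall a, sim_delta st (Some a) = (st, Some a, Some false)) ->
  sim_delta st None = (st', None, Some true) -> st != Stop ->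
  exists k', reaches step
    (conf st (behead (padded w k)) (head None (padded w k) :: r))
    (conf st' (nseq k' None) ([seq Some s | s <- rev w] ++ r)).
Proof.
move=> st_some st_none st_live; elim: w r => [|a w IHw] r.
  exists k.-1.+1; apply: reaches_step.
  have -> : head None (padded [::] k) = None by case: k.
  rewrite /zstep /= (negPf st_live) st_none; case: k => [|k]; exact: reaches_refl.
have [k' reach] := IHw (Some a :: r); exists k'; apply: reaches_step.
by rewrite /zstep /= (negPf st_live) st_some rev_cons map_rcons cat_rcons.
Qed.

Lemma reach_append q p e w j k : exists j' k',
  reaches step (conf (Append q p e) (nseq k None) (padded w j))
    (conf (Pop q p) (nseq k' None) (padded (w ++ HIST.word e) j')).
Proof.
case: e => [a|[a b]].
  have [k' reach] := reach_front (st := Return q p) (st' := Pop q p) (rev w) k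
    (Some a :: nseq j.-1 None) (fun=> erefl) erefl isT.
  (* The new symbol overwrites one explicit trailing blank, if there is any. *)
  exists j.-1, k'; apply: reaches_trans (reach_end _ _ _ _ _ _) _.
  apply: reaches_step; move: reach; rewrite revK map_cat -catA /=.
  by case: j => [|j].
(* The first symbol is written on the way right, so the sweep back starts on it. *)
have [k' reach] := reach_front (st := Return q p) (st' := Pop q p)
  (a :: rev w) k (Some b :: nseq j.-2 None) (fun=> erefl) erefl isT.
exists j.-2, k'; apply: reaches_trans (reach_end _ _ _ _ _ _) _.
do 2!apply: reaches_step; move: reach.
rewrite rev_cons revK map_rcons cat_rcons map_cat -catA /=.
by case: j => [|[|j]].
Qed.

(* Popped cells and the ends of the sweeps leave blanks around the window. *)
Definition sim_related (c : qconfig M) (z : zipper sim_tm) : Prop :=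
  exists j k, z = conf (Loop c.1 (parities c.2)) (nseq k None) (padded c.2 j).

(** A step without a move writes the scanned symbol back, which makes the blank explicit when the
    list is empty. *)
Lemma padded_rewrite w j : exists j',
  head (@None S) (padded w j) :: behead (padded w j) = padded w j'.
Proof. by case: w => [|a w]; [exists j.-1.+1; case: j|exists j]. Qed.

Lemma sim_related_step c z : sim_related c z -> ~~ qhalted c ->
  exists k, sim_related (qstep c) (iter k.+1 step z).
Proof.
case: c => q w [j [k ->]] /negPf live; rewrite /qhalted /= in live.
suff: exists2 z, reaches step (step (conf (Loop q (parities w)) (nseq k None)
    (padded w j))) z & sim_related (qstep (q, w)) z.
  by case=> z' [n <-] rel; exists n; rewrite iterSr.
rewrite /qstep live {1}/zstep /= live.
(* The parity hypothesis enters here: the 0/1 vector kept in the state stands in for the true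
   histogram. *)
have -> : HIST.delta q [ffun s => parities w s : nat] = HIST.delta q (qhist w).
  by apply: parityM => s; rewrite !ffunE oddb.
case: (HIST.delta _ _) => q' e /=.
have [j' ->] := padded_rewrite w j.
have [j2 [k2 reach]] := reach_append q' (flip (parities w) (HIST.word e)) e w j' k.
exists (step (conf (Pop q' (flip (parities w) (HIST.word e))) (nseq k2 None)
    (padded (w ++ HIST.word e) j2))).
  by apply: reaches_trans reach _; exact: reaches_step (reaches_refl _ _).
exists j2, k2.+1; rewrite flip_parities.
(* At least one symbol is appended, so [Pop] finds a cell to erase. *)
have : 0 < size (w ++ HIST.word e).
  by rewrite size_cat addn_gt0 orbC; case: (e) => [|[]].
case: (w ++ _) => [|a v] //= _.
by rewrite /zstep /= flip_parities_cons.
Qed.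

Lemma sim_related_halted y c z : sim_related c z -> qhalted c ->
  exists k, zhalted (iter k step z) /\ (qreads y c <-> zreads y (iter k step z)).
Proof.
case: c => q w [j [k ->]] halted; exists 1; rewrite /= /zstep /= (halted : q == _).
split; first exact: eqxx.
have [j' e] := padded_rewrite w j; rewrite /qreads /zreads /= e.
(* Just past the window both sides show their own blank, which is not a bit. *)
apply: (reads_word_transfer (f := Some) (n := size w)).
- by move=> ? ? [].
- by move=> i lt_iw; rewrite nth_cat size_map lt_iw (nth_map (HIST.blank M)).
- rewrite nth_default //; have := HIST.sym_uniq M.
  by rewrite /= !inE !negb_or => /and4P[/and3P[_ -> ->]].
- by rewrite nth_cat size_map ltnn subnn; case: j' {e}.
Qed.

Lemma sim_related_init x :
  exists k, sim_related (qinit M x) (iter k step (zinit sim_tm x)).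
Proof.
suff: exists2 z, reaches step (zinit sim_tm x) z & sim_related (qinit M x) z.
  by case=> z [k <-]; exists k.
(* The single [None] is the blank that ended the scan; it becomes the trailing padding [j = 1]. *)
have [k' reach] := reach_front
  (st := Rewind (HIST.start M) (parities (hist_word M x)))
  (st' := Loop (HIST.start M) (parities (hist_word M x)))
  (rev (hist_word M x)) 0 [:: None] (fun=> erefl) erefl isT.
rewrite revK in reach.
eexists; last by exists 1, k'.
have := reach_scan (parities [::]) [::] (hist_word M x) 0.
rewrite flip_parities /= !cats0 => scan; apply: reaches_trans reach.
have -> : zinit sim_tm x =
    conf (Scan (parities [::])) [::] [seq Some s | s <- hist_word M x].
  rewrite /zinit /tm_word /= -map_comp.
  by congr (_, _, _); apply: eq_map => -[].
apply: reaches_trans scan _; rewrite cats0.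
exact: reaches_step (reaches_refl _ _).
Qed.

Lemma sim_tm_equiv (P : qconfig M -> Prop) (P' : zipper sim_tm -> Prop) x :
  (forall c z, sim_related c z -> qhalted c ->
     exists k, zhalted (iter k step z) /\ (P c <-> P' (iter k step z))) ->
  (exists n, qhalted (iter n (@qstep M) (qinit M x)) /\ P (iter n (@qstep M) (qinit M x))) <->
  (exists n, zhalted (iter n step (zinit sim_tm x)) /\ P' (iter n step (zinit sim_tm x))).
Proof.
move=> Phalt; apply: simulation Phalt _.
- exact: qstep_halted.
- exact: zstep_halted.
- by move=> c z [j [k ->]].
- exact: sim_related_step.
- exact: sim_related_init.
Qed.

Lemma sim_tm_halts x : HIST.halts_on M x <-> TM.halts_on sim_tm x.
Proof.
rewrite hist_haltsP tm_haltsP.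
apply: (sim_tm_equiv (P := fun=> True) (P' := fun=> True)) => c z cz hc.
by have [k [hk _]] := sim_related_halted [::] cz hc; exists k.
Qed.

Lemma sim_tm_outputs x y : HIST.outputs_on M x y <-> TM.outputs_on sim_tm x y.
Proof.
rewrite hist_outputsP tm_outputsP.
apply: (sim_tm_equiv (P := qreads y) (P' := zreads y)) => c z.
exact: sim_related_halted.
Qed.

End SimulateParityHist.

(** * Reading the front of a queue through parities *)

(* A machine that reads the front symbol of a nonempty queue, removes it and
   appends a word. [first] is the word appended blindly to the input by the
   parity machine before it can know any parities to compare. *)
Section Reader.
Variables (S Q : finType) (start halt : Q) (first : S + S * S).
Variable delta : Q -> S -> Q * (S + S * S).
Variables (blank lmark zero one : S).
Hypothesis symU : uniq [:: blank; lmark; zero; one].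
Hypothesis start_live : start != halt.

Local Notation P := {ffun S -> bool}.
Local Notation bits x := [seq if b then one else zero | b <- x].

Definition rstep (c : Q * seq S) : Q * seq S :=
  let: (q, v) := c in
  if q == halt then c else
  if v is a :: w then let: (q', e) := delta q a in (q', w ++ HIST.word e)
  else c.

Definition rhalted (c : Q * seq S) : bool := c.1 == halt.

Definition rinit (x : seq bool) : Q * seq S := (start, bits x ++ HIST.word first).

(** The front symbol of the reader is the one that the parity machine has just lost from its window,
    hence [behead]. *)
Definition rreads (y : seq bool) (c : Q * seq S) : Prop :=
  reads_word zero one (nth blank (behead c.2)) y.

Lemma rstep_halted c : rhalted c -> rstep c = c.
Proof. by case: c => q v; rewrite /rhalted /rstep /= => ->. Qed.

(** A HIST machine has a single halting state, so the parities are normalized on halting. *)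
Definition reader_halt : option (Q * P) := Some (halt, parities [::]).

(** [p] holds the parities before the last removal and [p'] those after it; they differ exactly at
    the removed symbol. [None] is the start state, with no earlier parities to compare. *)
Definition reader_delta (st : option (Q * P)) (h : {ffun S -> nat}) :
    option (Q * P) * (S + S * S) :=
  let p' := [ffun s => odd (h s)] in
  if st is Some (q, p) then
    if [pick s | p' s != p s] is Some a then
      let: (q', e) := delta q a in
      (if q' == halt then reader_halt else Some (q', flip p' (HIST.word e)), e)
    else (st, inl blank)
  else (Some (start, flip p' (HIST.word first)), first).

Definition reader_hist : HIST.hist :=
  HIST.Machine symU None reader_halt reader_delta.

Lemma reader_parity : HIST.parity reader_hist.
Proof.
move=> st h1 h2 eq_h; rewrite /= /reader_delta.
suff -> : [ffun s => odd (h1 s)] = [ffun s => odd (h2 s)] by [].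
by apply/ffunP => s; rewrite !ffunE.
Qed.

(* The histogram of [w] and the remembered parities of [a :: w] reveal [a]. *)
Definition reader_related (c : Q * seq S) (d : qconfig reader_hist) : Prop :=
  exists a, c.2 = a :: d.2 /\
    d.1 = if c.1 == halt then reader_halt else Some (c.1, parities c.2).

Lemma pick_popped (a : S) (w : seq S) :
  [pick s | odd (count_mem s w) != parities (a :: w) s] = Some a.
Proof.
have parityE s : (odd (count_mem s w) != parities (a :: w) s) = (a == s).
  by rewrite ffunE /= oddD; case: (a == s); case: odd.
case: pickP => [s|/(_ a)]; rewrite parityE; first by move/eqP->.
by rewrite eqxx.
Qed.

Lemma odd_qhist (w : seq S) :
  [ffun s => odd (qhist (M := reader_hist) w s)] = parities w.
Proof. by apply/ffunP => s; rewrite !ffunE. Qed.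

Lemma word_cons (w : seq S) e :
  exists a, w ++ HIST.word e = a :: behead (w ++ HIST.word e).
Proof. by case: w => [|a w]; [case: e => [a|[a b]]; exists a|exists a]. Qed.

Lemma reader_related_step c d : reader_related c d -> ~~ rhalted c ->
  reader_related (rstep c) (qstep d).
Proof.
case: c d => q v [st w] [a [/= -> ->]] /negPf live; rewrite /rhalted /= in live.
rewrite /rstep /qstep live /= {1}/reader_halt.
have -> : (Some (q, parities (a :: w)) == Some (halt, parities [::])) = false.
  by apply/eqP => -[eq_q]; rewrite eq_q eqxx in live.
rewrite odd_qhist.
under eq_pick do rewrite ffunE.
rewrite pick_popped; case: (delta q a) => q' e; rewrite flip_parities.
by have [b eb] := word_cons w e; exists b.
Qed.

Lemma reader_equiv (A : Q * seq S -> Prop) (B : qconfig reader_hist -> Prop) x :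
  (forall c d, reader_related c d -> A c <-> B d) ->
  (exists n, rhalted (iter n rstep (rinit x)) /\ A (iter n rstep (rinit x))) <->
  (exists n, qhalted (iter n (@qstep reader_hist) (qinit reader_hist x)) /\
             B (iter n (@qstep reader_hist) (qinit reader_hist x))).
Proof.
move=> AB; apply: (simulation (R := reader_related)).
- exact: rstep_halted.
- exact: qstep_halted.
- move=> [q v] [st w] [a [/= _ ->]]; rewrite /qhalted /rhalted /=.
  by case: ifP => // live /eqP[eq_q]; rewrite eq_q eqxx in live.
- by move=> c d cd live; exists 0; apply: reader_related_step.
- move=> [q v] [st w] cd hc; exists 0; split; last exact: AB.
  by case: cd => a [/= _ ->]; rewrite [_ == halt]hc /qhalted eqxx.
(* One blind step appends [first] and drops the front symbol, which the next step can identify. *)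
- exists 1; rewrite /= /qstep /= odd_qhist flip_parities.
  have [a ea] := word_cons (bits x) first; exists a; split=> //=.
  by rewrite (negPf start_live).
Qed.

Lemma reader_halts x :
  (exists n, rhalted (iter n rstep (rinit x)) /\ True) <->
  HIST.halts_on reader_hist x.
Proof.
by rewrite hist_haltsP; apply: (reader_equiv (A := fun=> True) (B := fun=> True)).
Qed.

Lemma reader_outputs x y :
  (exists n, rhalted (iter n rstep (rinit x)) /\ rreads y (iter n rstep (rinit x))) <->
  HIST.outputs_on reader_hist x y.
Proof.
rewrite hist_outputsP; apply: (reader_equiv (A := rreads y) (B := qreads y)).
by move=> [q v] [st w] [a [/= -> _]].
Qed.

End Reader.

(** * A queue machine simulating a Turing machine *)

Section SimulateTM.
Variable M : TM.tm.

Local Notation G := (TM.sym M).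
Local Notation Q := (TM.state M).

(** [inl (g, b)] is a tape cell, with [b] marking the scanned one; the values of [option bool] are
    the three delimiters. *)
Definition cyc_sym : finType := (G * bool + option bool)%type.
Local Notation S := cyc_sym.

Definition cell (g : G) : S := inl (g, false).
Definition scanned (g : G) : S := inl (g, true).
Definition rend : S := inr (Some true).
Definition lend : S := inr (Some false).
Definition sep : S := inr None.

(* [Seek]: rotate until the scanned cell is read; [Mark]: the next cell becomes
   the scanned one; [Shift]: delay every cell by one until [sep] is read, when
   the cell held is the left neighbour; [Place], [Unwind]: bring the scanned cell
   just behind the front, since the symbol read last has left the window. *)
Inductive cyc_state :=
  | Mark of Q
  | Seek of Q
  | Shift of Q & S
  | Place of S
  | Unwind
  | Done.

Definition cyc_state_encode (s : cyc_state) :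
    option (Q + (Q + (Q * S + (S + unit)))) :=
  match s with
  | Mark q => Some (inl q)
  | Seek q => Some (inr (inl q))
  | Shift q c => Some (inr (inr (inl (q, c))))
  | Place c => Some (inr (inr (inr (inl c))))
  | Unwind => Some (inr (inr (inr (inr tt))))
  | Done => None
  end.

Definition cyc_state_decode s : cyc_state :=
  match s with
  | Some (inl q) => Mark q
  | Some (inr (inl q)) => Seek q
  | Some (inr (inr (inl (q, c)))) => Shift q c
  | Some (inr (inr (inr (inl c)))) => Place c
  | Some (inr (inr (inr (inr tt)))) => Unwind
  | None => Done
  end.

Lemma cyc_state_encodeK : cancel cyc_state_encode cyc_state_decode.
Proof. by case. Qed.

HB.instance Definition _ := Countable.copy cyc_state (can_type cyc_state_encodeK).
HB.instance Definition _ : isFinite cyc_state := CanIsFinite cyc_state_encodeK.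

Definition cyc_delta (st : cyc_state) (a : S) : cyc_state * (S + S * S) :=
  match st with
  | Mark q =>
      if a is inl (g, _) then (Seek q, inl (scanned g))
      else (Seek q, inr (scanned (TM.blank M), rend))
  | Seek q =>
      if a is inl (s, true) then
        if q == TM.halt M then (Place (cell s), inr (sep, rend)) else
        let: (q', s', m) := TM.delta q s in
        match m with
        | None => (Seek q', inl (scanned s'))
        | Some true => (Mark q', inl (cell s'))
        | Some false => (Shift q' (cell s'), inl sep)
        end
      else (st, inl a)
  | Shift q c =>
      if a == sep then
        if c is inl (g, _) then (Seek q, inl (scanned g))
        else (Seek q, inr (lend, scanned (TM.blank M)))
      else (Shift q a, inl c)
  | Place c => (Unwind, inr (c, a))
  | Unwind => if a == sep then (Done, inl a) else (st, inl a)
  | Done => (st, inl a)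
  end.

(** In the HIST alphabet [rend] serves as the blank and [lend] as the start symbol. *)
Lemma cyc_symU :
  uniq [:: rend; lend; cell (TM.zero M); cell (TM.one M)].
Proof.
have := TM.sym_uniq M; rewrite /= !inE !negb_or !andbT => /andP[_].
by apply: contra => /eqP[->].
Qed.

Local Notation step := (@rstep S cyc_state Done cyc_delta).
Local Notation conf st v := ((st : cyc_state, v) : cyc_state * seq S).
Local Notation cells w := [seq cell g | g <- w].

(* The tape without its scanned cell, read cyclically: the cells to the right,
   the two end markers, where blanks are inserted on demand, then the cells to
   the left. *)
Definition around (l r : seq G) : seq S :=
  cells (behead r) ++ rend :: lend :: cells (rev l).

Definition cyclic (l r : seq G) : seq S :=
  scanned (head (TM.blank M) r) :: around l r.

Definition plain (a : S) : bool :=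
  match a with
  | inl (_, true) | inr None => false
  | _ => true
  end.

Lemma plain_neq_sep a : plain a -> (a == sep) = false.
Proof. by case: a => [[g []]|[[]|]]. Qed.

Lemma cells_plain w : all plain (cells w).
Proof. by rewrite all_map; apply/allP. Qed.

Lemma around_plain l r : all plain (around l r).
Proof. by rewrite all_cat /= !cells_plain. Qed.

Lemma reach_rotate st u v : st != Done ->
  all (fun a => cyc_delta st a == (st, inl a)) u ->
  reaches step (conf st (u ++ v)) (conf st (v ++ u)).
Proof.
move=> live; elim: u v => [|a u IHu] v /=.
  by rewrite cats0 => _; exact: reaches_refl.
move=> /andP[/eqP fix_a /IHu reach]; apply: reaches_step.
rewrite /rstep (negPf live) fix_a /= -catA.
by have := reach (v ++ [:: a]); rewrite -!catA.
Qed.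

Lemma reach_seek q u v : all plain u ->
  reaches step (conf (Seek q) (u ++ v)) (conf (Seek q) (v ++ u)).
Proof.
move=> plain_u; apply: reach_rotate => //; apply: sub_all plain_u => a /=.
by case: a => [[g []]|[]] //= _; rewrite eqxx.
Qed.

Lemma reach_mark q l r :
  reaches step (conf (Mark q) (cells r ++ rend :: lend :: cells (rev l)))
    (conf (Seek q) (cyclic l r)).
Proof.
apply: reaches_step; case: r => [|g r].
  (* Nothing lies to the right: [rend] is read, and a marked blank is inserted before it. *)
  have := @reach_seek q (lend :: cells (rev l)) [:: scanned (TM.blank M); rend].
  by rewrite /= cells_plain; apply.
exact: (reach_seek q [:: scanned g] (around_plain l (g :: r))).
Qed.

(** Of the delayed stream [c :: u], all but the last symbol has been appended again and the last one
    is held in the state. *)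
Lemma reach_shift q c u v : all plain u ->
  reaches step (conf (Shift q c) (u ++ sep :: v))
    (conf (Shift q (last c u)) (sep :: v ++ belast c u)).
Proof.
elim: u c v => [|a u IHu] c v /=.
  by rewrite cats0 => _; exact: reaches_refl.
move=> /andP[/plain_neq_sep a_sep /IHu reach]; apply: reaches_step.
rewrite /rstep /= a_sep -catA /=.
by have := reach a (v ++ [:: c]); rewrite -catA.
Qed.

(** [sep] fills the slot of the symbol held in the state. When it comes round, the held symbol is
    the left neighbour, which takes its place with the mark. *)
Lemma reach_left q s l r :
  reaches step (conf (Shift q (cell s)) (around l r ++ [:: sep]))
    (conf (Seek q)
       (cyclic (behead l) (head (TM.blank M) l :: s :: behead r))).
Proof.
apply: reaches_trans (reach_shift q (cell s) [::] (around_plain l r)) _.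
have plain_l l' := around_plain l' [:: s, s & behead r].
apply: reaches_step; case: l => [|g l].
  (* With no cell to the left, the held symbol is [lend], and a marked blank is inserted after
     it. *)
  have -> : around [::] r = rcons (cells (behead r) ++ [:: rend]) lend.
    by rewrite -cats1 -catA.
  rewrite last_rcons belast_rcons.
  have := reach_seek q [:: scanned (TM.blank M)] (plain_l [::]).
  by rewrite /rstep /= /cyclic /around /= -!catA.
rewrite /around rev_cons map_rcons -!rcons_cons -rcons_cat last_rcons belast_rcons.
exact: (reach_seek q [:: scanned g] (plain_l l)).
Qed.

Definition cyc_related (z : zipper M) (c : cyc_state * seq S) : Prop :=
  c = conf (Seek z.1.1) (cyclic z.1.2 z.2).

Lemma cyc_related_step z c : cyc_related z c -> ~~ zhalted z ->
  exists k, cyc_related (zstep z) (iter k.+1 step c).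
Proof.
case: z => [[q l] r] -> /negPf live; rewrite /zhalted /= in live.
suff [k ek] : reaches step (step (conf (Seek q) (cyclic l r)))
    (conf (Seek (zstep (q, l, r)).1.1)
      (cyclic (zstep (q, l, r)).1.2 (zstep (q, l, r)).2)).
  by exists k; rewrite iterSr.
rewrite /rstep /= live; case: (TM.delta _ _) => [[q' s] m].
case: m => [[]|] /=.
- have := reach_mark q' (s :: l) (behead r).
  by rewrite rev_cons map_rcons -cats1 /around -catA.
- exact: reach_left.
- exact: (reach_seek q' [:: scanned s] (around_plain l (s :: behead r))).
Qed.

Local Notation creads := (rreads rend (cell (TM.zero M)) (cell (TM.one M))).

Lemma cyc_reads y q l r (v : seq S) st :
  zreads y ((q, l, r) : zipper M) <->
  creads y (conf st [:: rend, cell (head (TM.blank M) r) & around l r ++ v]).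
Proof.
(* [r] may be empty while the queue always holds a scanned cell. Position [n] is where [rend] stands
   in the queue. *)
apply: (reads_word_transfer (n := size (head (TM.blank M) r :: behead r))).
- by move=> g g' [].
- move=> i lt_i /=.
  rewrite /around -catA -cat_cons -map_cons nth_cat size_map lt_i.
  rewrite (nth_map (TM.blank M)) //.
  by case: r i lt_i => [|g r] [|i] //=; rewrite nth_nil.
- rewrite nth_default; last by case: (r) => /=.
  by have := TM.sym_uniq M; rewrite /= negb_or => /andP[].
- by rewrite /= /around -catA nth_cat size_map ltnn subnn.
Qed.

(** On halting, [sep], [rend] and the scanned cell are queued in this order. Reading [sep] then
    leaves [rend] as the front symbol, outside the window, so the window starts with the scanned
    cell. *)
Lemma cyc_related_halted y z c : cyc_related z c -> zhalted z ->
  exists k, rhalted Done (iter k step c) /\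
    (zreads y z <-> creads y (iter k step c)).
Proof.
case: z => [[q l] r] -> halted.
suff [k ek] : reaches step (conf (Seek q) (cyclic l r))
    (conf Done [:: rend, cell (head (TM.blank M) r) & around l r ++ [:: sep]]).
  by exists k; rewrite ek; split=> //; apply: cyc_reads.
apply: reaches_step; rewrite /rstep /= [_ == _]halted.
(* The end markers keep [around l r] nonempty, so [Place] reads one of its symbols, not [sep]. *)
have := around_plain l r; have : 0 < size (around l r).
  by rewrite size_cat addnS.
case: (around l r) => [|a u] //= _ /andP[_ plain_u].
apply: reaches_step; rewrite /rstep /= -catA /=.
apply: reaches_trans (reach_rotate _ _ _) _ => //.
  by apply: sub_all plain_u => b /plain_neq_sep /= ->.
exact: reaches_step (reaches_refl _ _).
Qed.

(** The blind first word supplies the two end markers. The queue is then a tape without a mark, and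
    [Mark] puts the head on its first cell. *)
Definition cyc_hist : HIST.hist :=
  reader_hist (Mark (TM.start M)) Done (inr (rend, lend)) cyc_delta cyc_symU.

Local Notation cinit := (rinit (Mark (TM.start M)) (inr (rend, lend))
  (cell (TM.zero M)) (cell (TM.one M))).

Lemma cyc_equiv (A : zipper M -> Prop) (B : cyc_state * seq S -> Prop) x :
  (forall z c, cyc_related z c -> zhalted z ->
     exists k, rhalted Done (iter k step c) /\ (A z <-> B (iter k step c))) ->
  (exists n, zhalted (iter n (@zstep M) (zinit M x)) /\
             A (iter n (@zstep M) (zinit M x))) <->
  (exists n, rhalted Done (iter n step (cinit x)) /\ B (iter n step (cinit x))).
Proof.
move=> AB; apply: simulation AB _.
- exact: zstep_halted.
- exact: rstep_halted.
- by move=> z c ->.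
- exact: cyc_related_step.
- have [k ek] := reach_mark (TM.start M) [::] (tm_word M x).
  exists k; rewrite /cyc_related -ek /rinit /tm_word -map_comp.
  by congr (iter _ _ (_, _ ++ _)); apply: eq_map => -[].
Qed.

Lemma cyc_hist_parity : HIST.parity cyc_hist.
Proof. exact: reader_parity. Qed.

Lemma cyc_hist_halts x : TM.halts_on M x <-> HIST.halts_on cyc_hist x.
Proof.
rewrite -reader_halts // tm_haltsP.
apply: (cyc_equiv (A := fun=> True) (B := fun=> True)) => z c zc hz.
by have [k [hk _]] := cyc_related_halted [::] zc hz; exists k.
Qed.

Lemma cyc_hist_outputs x y : TM.outputs_on M x y <-> HIST.outputs_on cyc_hist x y.
Proof.
rewrite -reader_outputs // tm_outputsP.
apply: (cyc_equiv (A := zreads y) (B := creads y)) => z c.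
exact: cyc_related_halted.
Qed.

End SimulateTM.

Theorem theorem1 : turing_complete HIST.parity_model.
Proof.
split=> [L|F]; split=> -[M HM].
- by exists (sim_tm (sval M)) => x; rewrite HM; apply: (sim_tm_halts (svalP M)).
- exists (exist _ (cyc_hist M) (@cyc_hist_parity M)) => x.
  by rewrite HM; apply: cyc_hist_halts.
- by exists (sim_tm (sval M)) => x y; rewrite HM; apply: (sim_tm_outputs (svalP M)).
- exists (exist _ (cyc_hist M) (@cyc_hist_parity M)) => x y.
  by rewrite HM; apply: cyc_hist_outputs.
Qed.
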